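(* A division ring $D$ is weakly locally finite if and only if $D$, regarded as an algebra over its center $F$, is locally PI.
   Context: A division ring is centrally finite if it is finite dimensional as a vector space over its own center. A division ring $D$ is weakly locally finite if for every finite subset $S\subseteq D$, the division subring of $D$ generated by $S$ is centrally finite (i.e. finite dimensional over its own center). An algebra $A$ over a field $k$ is locally PI if every finitely generated $k$-subalgebra of $A$ satisfies a polynomial identity. *)

(* Defs.v *)
From mathcomp Require Import all_boot all_algebra.
Set Implicit Arguments. Unset Strict Implicit. Unset Printing Implicit Defensive.
Import GRing.Theory.
Local Open Scope ring_scope.

Section Defs.
Variable D : unitRingType.

Definition is_division_ring : Prop := forall x : D, x != 0 -> x \is a GRing.unit.

Definition central (z : D) : Prop := forall y : D, z * y = y * z.

Definition center_of (E : D -> Prop) (z : D) : Prop :=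
  E z /\ forall y, E y -> z * y = y * z.

Definition centrally_finite (E : D -> Prop) : Prop :=
  exists b : seq D,
    (forall x, x \in b -> E x) /\
    (forall x, E x -> exists c : seq D, size c = size b /\
        (forall i, (i < size b)%N -> center_of E c`_i) /\
        x = \sum_(i < size b) c`_i * b`_i) /\
    (forall c : seq D, size c = size b ->
        (forall i, (i < size b)%N -> center_of E c`_i) ->
        \sum_(i < size b) c`_i * b`_i = 0 ->
        forall i, (i < size b)%N -> c`_i = 0).

Definition divring_closedP (P : D -> Prop) : Prop :=
  [/\ P 1, (forall x y, P x -> P y -> P (x - y)),
      (forall x y, P x -> P y -> P (x * y)) & (forall x, P x -> P x^-1)].

Definition gen_divring (S : seq D) (x : D) : Prop :=
  forall P, divring_closedP P -> (forall s, s \in S -> P s) -> P x.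

Definition weakly_locally_finite : Prop :=
  forall S : seq D, centrally_finite (gen_divring S).

Definition subalg_closedP (P : D -> Prop) : Prop :=
  [/\ (forall z, central z -> P z),
      (forall x y, P x -> P y -> P (x - y)) &
      (forall x y, P x -> P y -> P (x * y))].

Definition gen_subalg (S : seq D) (x : D) : Prop :=
  forall P, subalg_closedP P -> (forall s, s \in S -> P s) -> P x.

(* Noncommutative polynomials in variables x_0, x_1, ... as finite formal
   sums of terms (coefficient, word); coefficients are required to lie in F. *)
Definition ncpoly := seq (D * seq nat).

Definition ncpoly_over_center (p : ncpoly) : Prop :=
  forall t, t \in p -> central t.1.

(* the element of the free algebra represented by p is nonzero *)
Definition ncpoly_nonzero (p : ncpoly) : Prop :=
  exists w : seq nat, \sum_(t <- p | t.2 == w) t.1 != 0.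

Definition ncpoly_eval (p : ncpoly) (a : nat -> D) : D :=
  \sum_(t <- p) t.1 * \prod_(i <- t.2) a i.

Definition satisfies_PI (A : D -> Prop) : Prop :=
  exists p : ncpoly, [/\ ncpoly_over_center p, ncpoly_nonzero p &
    forall a : nat -> D, (forall i, A (a i)) -> ncpoly_eval p a = 0].

Definition locally_PI : Prop :=
  forall S : seq D, satisfies_PI (gen_subalg S).

End Defs.

(* Main.v *)
(** Let R be a subring of a division ring E that generates E as a division ring,
    and suppose that R satisfies a polynomial identity with coefficients in E.
    Linearizing a monomial of maximal length gives a nonzero multilinear
    identity. If E were infinite dimensional over its center Z, then an
    elementary operator y |-> \sum b_i y c_i whose values on R span a finite
    dimensional Z-space would vanish on R; it follows that in an identity which
    is bilinear in x and y the terms with x before y and those with y before x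
    vanish separately. Separating all pairs of variables leaves an identity with
    a single monomial, which is absurd. So E is finite over Z.

    If D is locally PI, this applies to F[S] inside the division ring Q that it
    generates. A division ring of dimension n over its center satisfies the
    standard identity of degree n + 1,
      so the division ring generated by S alone,
    being contained in Q, satisfies a standard identity, and is in turn finite
    over its own center. Conversely, if the division ring generated by S is
    spanned by n elements over its center, then F[S] is spanned by them over a
    commutative ring centralizing them, hence satisfies the standard identity of
    degree n + 1. *)
Require Import Defs.
From mathcomp Require Import all_boot all_fingroup all_algebra.
From mathcomp Require Import boolp.
Set Implicit Arguments. Unset Strict Implicit. Unset Printing Implicit
  Defensive.
Import GRing.Theory.
Local Open Scope ring_scope.

(** * Spans over a subring *)

Section Span.
Variable D : unitRingType.
Implicit Types (Z : D -> Prop) (V : seq D).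

(** Coefficients act on the left; the recursion peels off one generator at a time, and [cspan_sumP]
    recovers the usual indexed sum. *)
Fixpoint cspan Z V (x : D) : Prop :=
  if V is v :: V' then exists2 z, Z z & cspan Z V' (x - z * v) else x = 0.

Definition subringP Z : Prop :=
  [/\ Z 1, (forall x y, Z x -> Z y -> Z (x - y)) &
      (forall x y, Z x -> Z y -> Z (x * y))].

Section Subring.
Variable Z : D -> Prop.
Hypothesis Zring : subringP Z.

Lemma subringP1 : Z 1. Proof. by case: Zring. Qed.
Lemma subringPB x y : Z x -> Z y -> Z (x - y).
Proof. by case: Zring => _ + _; apply. Qed.
Lemma subringPM x y : Z x -> Z y -> Z (x * y).
Proof. by case: Zring => _ _; apply. Qed.
Lemma subringP0 : Z 0.
Proof. by rewrite -(subrr 1); apply: subringPB; exact: subringP1. Qed.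
Lemma subringPN x : Z x -> Z (- x).
Proof. by rewrite -sub0r; apply: subringPB; exact: subringP0. Qed.
Lemma subringPD x y : Z x -> Z y -> Z (x + y).
Proof. by move=> Zx Zy; rewrite -[y]opprK; apply/subringPB/subringPN. Qed.

Lemma subringP_sum (I : Type) (r : seq I) (P : pred I) (F : I -> D) :
  (forall i, P i -> Z (F i)) -> Z (\sum_(i <- r | P i) F i).
Proof.
move=> ZF; elim/big_rec: _ => [|i x Pi Zx]; first exact: subringP0.
by apply: subringPD => //; apply: ZF.
Qed.

Lemma subringP_prod (I : Type) (r : seq I) (P : pred I) (F : I -> D) :
  (forall i, P i -> Z (F i)) -> Z (\prod_(i <- r | P i) F i).
Proof.
move=> ZF; elim/big_rec: _ => [|i x Pi Zx]; first exact: subringP1.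
by apply: subringPM => //; apply: ZF.
Qed.

Lemma subringP_exp x n : Z x -> Z (x ^+ n).
Proof.
move=> Zx; elim: n => [|n IH]; first exact: subringP1.
by rewrite exprS; apply: subringPM.
Qed.

Lemma cspan0 V : cspan Z V 0.
Proof.
elim: V => //= v V IH; exists 0; first exact: subringP0.
by rewrite mul0r subr0.
Qed.

Lemma cspanB V x y : cspan Z V x -> cspan Z V y -> cspan Z V (x - y).
Proof.
elim: V x y => /= [x y -> ->|v V IH x y [a Za Vx] [b Zb Vy]];
  first exact: subrr.
exists (a - b); first exact: subringPB.
have -> : x - y - (a - b) * v = (x - a * v) - (y - b * v); last exact: IH.
by rewrite mulrBl !opprB addrACA [RHS]addrACA [- y + _]addrC.
Qed.

Lemma cspanD V x y : cspan Z V x -> cspan Z V y -> cspan Z V (x + y).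
Proof.
move=> Vx Vy; rewrite -[y]opprK; apply: cspanB => //; rewrite -sub0r.
by apply: cspanB => //; exact: cspan0.
Qed.

Lemma cspanZ V z x : Z z -> cspan Z V x -> cspan Z V (z * x).
Proof.
move=> Zz; elim: V x => /= [x ->|v V IH x [a Za Vx]]; first exact: mulr0.
exists (z * a); first exact: subringPM.
by rewrite -mulrA -mulrBr; apply: IH.
Qed.

Lemma cspan_mem V v : v \in V -> cspan Z V v.
Proof.
elim: V => //= u V IH; rewrite inE => /orP[/eqP->|Vv].
  by exists 1; [exact: subringP1|rewrite mul1r subrr; exact: cspan0].
by exists 0; [exact: subringP0|rewrite mul0r subr0; exact: IH].
Qed.

Lemma cspan_ind V (P : D -> Prop) :
  P 0 -> (forall z v y, Z z -> v \in V -> P y -> P (z * v + y)) ->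
  forall x, cspan Z V x -> P x.
Proof.
elim: V => /= [P0 _ x -> //|v V IH P0 PD x [z Zz Vx]].
have -> : x = z * v + (x - z * v) by rewrite addrC subrK.
apply: (PD); rewrite ?mem_head //; apply: IH Vx => // y u x' Zy Vu.
by apply: PD => //; rewrite inE Vu orbT.
Qed.

Lemma cspan_trans V V' x :
  (forall v, v \in V -> cspan Z V' v) -> cspan Z V x -> cspan Z V' x.
Proof.
move=> VV'; elim/cspan_ind => [|z v y Zz Vv V'y]; first exact: cspan0.
by apply: cspanD => //; apply: cspanZ => //; apply: VV'.
Qed.

Lemma cspan_mulr V x b : cspan Z V x -> cspan Z [seq v * b | v <- V] (x * b).
Proof.
elim/cspan_ind => [|z v y Zz Vv IH]; first by rewrite mul0r; exact: cspan0.
rewrite mulrDl -mulrA; apply: cspanD => //; apply: cspanZ => //.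
by apply: cspan_mem; apply/mapP; exists v.
Qed.

Lemma cspan_mull V x a : (forall z, Z z -> a * z = z * a) ->
  cspan Z V x -> cspan Z [seq a * v | v <- V] (a * x).
Proof.
move=> aZ; elim/cspan_ind => [|z v y Zz Vv IH]; first by rewrite mulr0;
  exact: cspan0.
rewrite mulrDr mulrA aZ // -mulrA; apply: cspanD => //; apply: cspanZ => //.
by apply: cspan_mem; apply/mapP; exists v.
Qed.

Lemma cspan_sumP V x : cspan Z V x <->
  exists2 c : nat -> D, (forall i, Z (c i)) & x = \sum_(i < size V) c i * V`_i.
Proof.
split=> [|[c Zc ->]]; last first.
  elim/big_rec: _ => [|i y _ Vy]; first exact: cspan0.
  by apply: cspanD => //; apply: cspanZ => //; apply/cspan_mem/mem_nth.
elim: V x => /= [x ->|v V IH x [z Zz /IH[c Zc xE]]].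
  by exists (fun=> 0); [move=> _; exact: subringP0|rewrite big_ord0].
exists (fun i => if i is i'.+1 then c i' else z); first by case.
by rewrite big_ord_recl /= -xE addrC subrK.
Qed.

End Subring.

Lemma cspan_sub_coef Z Z' V x :
  (forall z, Z z -> Z' z) -> cspan Z V x -> cspan Z' V x.
Proof.
by move=> ZZ'; elim: V x => //= v V IH x [z /ZZ' Zz /IH Vx]; exists z.
Qed.

End Span.

(** * Division subrings and finite dimensionality *)

Section DivisionRing.
Variable D : unitRingType.
Hypothesis hD : is_division_ring D.

Lemma divring_mulVr (x : D) : x != 0 -> x^-1 * x = 1.
Proof. by move=> x0; rewrite mulVr // hD. Qed.

Lemma divring_mulrV (x : D) : x != 0 -> x * x^-1 = 1.
Proof. by move=> x0; rewrite divrr // hD. Qed.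

Lemma divring_mulrI (x y : D) : x != 0 -> x * y = 0 -> y = 0.
Proof. by move=> /hD ux xy0; apply: (mulrI ux); rewrite mulr0. Qed.

Lemma divring_subringP (E : D -> Prop) : divring_closedP E -> subringP E.
Proof. by case. Qed.

Lemma center_divring (E : D -> Prop) :
  divring_closedP E -> divring_closedP (center_of E).
Proof.
case=> E1 EB EM EV; split.
- by split=> // y _; rewrite mul1r mulr1.
- move=> x y [Ex xC] [Ey yC]; split=> [|u Eu]; first exact: EB.
  by rewrite mulrBl mulrBr xC // yC.
- move=> x y [Ex xC] [Ey yC]; split=> [|u Eu]; first exact: EM.
  by rewrite -mulrA yC // mulrA xC // mulrA.
- move=> x [Ex xC]; split=> [|u Eu]; first exact: EV.
  exact/esym/(commrV (esym (xC u Eu))).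
Qed.

Section FiniteDimensional.
Variable Z : D -> Prop.
Hypothesis Zdiv : divring_closedP Z.
Let Zring := divring_subringP Zdiv.

(** Gaussian elimination, by induction on [V]: a term [v k] that needs the first generator [b] is
    used to eliminate [b] from all later terms, which leaves a sequence in the span of the remaining
    generators. *)
Lemma cspan_dependent V (v : nat -> D) :
  (forall i, cspan Z V (v i)) -> exists k, cspan Z (mkseq v k) (v k).
Proof.
elim: V v => [|b V IH] v Vv; first by exists 0%N; apply: Vv.
have [vV|/existsNP[k vk]] := EM (forall i, cspan Z V (v i)); first exact: IH.
have [z Zz Vz] := Vv k.
have z0 : z != 0.
  by apply/eqP => z0; apply: vk; rewrite z0 mul0r subr0 in Vz.
(* With [y] and [z] the coefficients of [b] in the later term and in [v k], subtracting [y * z^-1]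
   times [v k] cancels [b]. *)
have /choice[f fP] i :
    exists y, Z y /\ cspan Z V (v (k.+1 + i)%N - y * v k).
  have [y Zy Vy] := Vv (k.+1 + i)%N; exists (y * z^-1).
  have Zyz : Z (y * z^-1) by case: Zdiv => _ _ + ZV; apply=> //; apply: ZV.
  split=> //; have := cspanB Zring Vy (cspanZ Zring Zyz Vz).
  by rewrite mulrBr -!mulrA (mulrA z^-1) divring_mulVr // mul1r opprB addrA
    subrK.
have [j vj] := IH (fun i => v (k.+1 + i)%N - f i * v k) (fun i => (fP i).2).
exists (k.+1 + j)%N.
have Vvk : cspan Z (mkseq v (k.+1 + j)) (v k).
  by apply: cspan_mem => //; apply: map_f; rewrite mem_iota /= add0n leq_addr.
rewrite -[v (k.+1 + j)%N](subrK (f j * v k)).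
apply: cspanD => //; last by apply: cspanZ => //; exact: (fP j).1.
apply: cspan_trans vj => // x /mapP[i]; rewrite mem_iota => /andP[_ ij] ->.
apply: cspanB => //; last by apply: cspanZ => //; exact: (fP i).1.
by apply: cspan_mem => //; apply: map_f; rewrite mem_iota add0n ltn_add2l.
Qed.

(** Multiplying the relation by [w^-1] expresses [z * w^-1], where [z] is its constant coefficient,
    through powers of [w]; if [z] vanishes, the result is a relation of lower degree. *)
Lemma cspan_pow_inv (W : D -> Prop) (w : D) k :
  subringP W -> (forall z, Z z -> W z) -> W w -> w != 0 ->
  cspan Z (mkseq (GRing.exp w) k) (w ^+ k) -> W w^-1.
Proof.
move=> Wring ZW Ww w0; elim: k => [|k IH].
  by move=> /= /eqP; rewrite expr0 oner_eq0.
rewrite /mkseq /= => -[z Zz].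
move=> /(cspan_mulr Zring w^-1).
rewrite mulrBl expr0 mulr1 exprSr -mulrA divring_mulrV // mulr1.
have -> : [seq v * w^-1 | v <- [seq w ^+ i | i <- iota 1 k]]
    = mkseq (GRing.exp w) k.
  rewrite -[1%N]addn0 iotaDl -!map_comp; apply: eq_map => i /=.
  by rewrite exprSr -mulrA divring_mulrV // mulr1.
have [->|z0] := eqVneq z 0; first by rewrite mul0r subr0.
move=> Vx; have Wx : W (w ^+ k - z * w^-1).
  apply: cspan_ind Vx => [|y v x Zy /mapP[i _ ->] Wx]; first exact: subringP0.
  apply: subringPD => //; apply: subringPM => //; first exact: ZW.
  exact: subringP_exp.
have Wzw : W (z * w^-1).
  rewrite -[z * _](subKr (w ^+ k)); apply: subringPB => //.
  exact: subringP_exp.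
rewrite -[w^-1]mul1r -(divring_mulVr z0) -mulrA; apply: subringPM => //.
by apply: ZW; case: Zdiv => _ _ _; apply.
Qed.

End FiniteDimensional.

(** A spanning family is thinned to a basis: while some relation has a nonzero coefficient, the
    corresponding vector depends on the others and is dropped. *)
Lemma centrally_finite_cspan (E : D -> Prop) V : divring_closedP E ->
  (forall v, v \in V -> E v) -> (forall x, E x -> cspan (center_of E) V x) ->
  centrally_finite E.
Proof.
move=> Ediv; have Zdiv := center_divring Ediv.
have Zring := divring_subringP Zdiv.
have [n] := ubnP (size V); elim: n V => // n IH V ltVn EV VE.
have [[c [szc Zc c0 [i ltiV ci]]]|indep] :=
  EM (exists c : seq D, [/\ size c = size V,
    (forall i, (i < size V)%N -> center_of E c`_i),
    \sum_(i < size V) c`_i * V`_i = 0 &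
    exists2 i, (i < size V)%N & c`_i <> 0]); last first.
  exists V; split=> //;
    split=> [x /VE /(cspan_sumP Zring)[c Zc ->]|c szc Zc c0 i ltiV].
    exists (mkseq c (size V)); rewrite size_mkseq; split=> //; split=> [j ltj|].
      by rewrite nth_mkseq.
    by apply: eq_bigr => j _; rewrite nth_mkseq.
  have [//|ci] := EM (c`_i = 0).
  by case: indep; exists c; split=> //; exists i.
have Vsplit : V = take i V ++ V`_i :: drop i.+1 V by rewrite -drop_nth //
  cat_take_drop.
pose V' := take i V ++ drop i.+1 V.
have VV' v : v \in V' -> v \in V.
  by rewrite [in X in _ -> X]Vsplit !mem_cat inE => /orP[->//|->];
    rewrite !orbT.
apply: (IH V').
- rewrite ltnS in ltVn; apply: leq_trans ltVn;
    rewrite [in X in (_ < X)%N]Vsplit !size_cat /=.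
  by rewrite addnS.
- by move=> v /VV'; apply: EV.
move=> x /VE; apply: cspan_trans => // v.
have V'j j : (j < size V)%N -> j != i -> cspan (center_of E) V' V`_j.
  move=> ltj ji; apply: cspan_mem => //; rewrite mem_cat.
  case: (ltngtP j i) ji => // ltij _.
    by rewrite -(nth_take _ ltij) mem_nth // size_take ltiV.
  have -> : V`_j = (drop i.+1 V)`_(j - i.+1) by rewrite nth_drop subnKC.
  by rewrite mem_nth ?orbT // size_drop ltn_sub2r // (leq_trans _ ltj).
move=> /(nthP 0)[j ltj <-]; have [->|ji] := eqVneq j i; last exact: V'j.
move/eqP: c0; rewrite (bigD1 (Ordinal ltiV)) //= addrC addr_eq0 => /eqP c0.
move/eqP: ci => ci; have Zci := Zc _ ltiV.
rewrite -[V`_i]mul1r -(divring_mulVr ci) -mulrA -[c`_i * _]opprK -c0.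
apply: cspanZ => //; first by case: Zdiv => _ _ _; apply.
rewrite -sub0r; apply: cspanB => //; first exact: cspan0.
elim/big_rec: _ => [|k y ki Vy]; first exact: cspan0.
by apply: cspanD => //; apply: cspanZ => //; [exact: Zc|exact: V'j].
Qed.

End DivisionRing.

(** * Elementary operators *)

Section Generation.
Variable D : unitRingType.
Hypothesis hD : is_division_ring D.
Variables E R : D -> Prop.
Hypothesis Ediv : divring_closedP E.
Hypothesis Rring : subringP R.
Hypothesis RE : forall x, R x -> E x.
Hypothesis E_gen : forall P : D -> Prop,
  divring_closedP P -> (forall x, R x -> P x) -> forall x, E x -> P x.
Notation Z := (center_of E).
Let Ering := divring_subringP Ediv.
Let Zdiv := center_divring Ediv.
Let Zring := divring_subringP Zdiv.
Let EV x : E x -> E x^-1. Proof. by case: Ediv => _ _ _; apply. Qed.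
Let ZV x : Z x -> Z x^-1. Proof. by case: Zdiv => _ _ _; apply. Qed.

Definition finite_over_center : Prop :=
  exists2 V : seq D, (forall v, v \in V -> E v) & (forall x, E x ->
    cspan Z V x).

(** The elements commuting with [c] form a division subring, which contains [E] as soon as it
    contains [R]. *)
Lemma center_of_gen c : E c -> (forall u, R u -> u * c = c * u) -> Z c.
Proof.
move=> Ec Rc; split=> //; apply: E_gen => [|x Rx]; last by rewrite Rc.
split=> [|x y cx cy|x y cx cy|x cx].
- by rewrite mul1r mulr1.
- by rewrite mulrBl mulrBr cx cy.
- by rewrite -mulrA -cy !mulrA cx.
- exact: commrV.
Qed.

(* The Z-span of R is a finite-dimensional domain over Z, hence closed under
   inversion, hence all of E. *)
Lemma finite_over_center_gen V : (forall v, v \in V -> E v) ->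
  (forall x, R x -> cspan Z V x) -> finite_over_center.
Proof.
move=> VE RV; exists V => //.
pose W x := forall P : D -> Prop, (forall y z, P y -> P z -> P (y - z)) ->
  (forall z y, Z z -> P y -> P (z * y)) -> (forall y, R y -> P y) -> P x.
have RW x : R x -> W x by move=> Rx P _ _; apply.
have WV x : W x -> cspan Z V x.
  by apply=> // [y z|z y]; [exact: cspanB|exact: cspanZ].
have WB x y : W x -> W y -> W (x - y).
  by move=> Wx Wy P PB PZ PR; apply: (PB); [apply: Wx|apply: Wy].
have WZ z x : Z z -> W x -> W (z * x).
  by move=> Zz Wx P PB PZ PR; apply: (PZ) => //; apply: Wx.
have WE x : W x -> E x.
  apply=> // [y z|z y [Ez _]]; first exact: subringPB.
  exact: subringPM.
have W1 : W 1 by apply: RW; exact: subringP1.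
have Wring : subringP W.
  split=> // x y Wx Wy;
    apply: (Wx (fun x => W (x * y))) => [a b Wa Wb|z a Zz Wa|a Ra].
  - by rewrite mulrBl; apply: WB.
  - by rewrite -mulrA; apply: WZ.
  apply: (Wy (fun y => W (a * y))) => [b c Wb Wc|z b Zz Wb|b Rb].
  - by rewrite mulrBr; apply: WB.
  - by rewrite mulrA -(proj2 Zz) -?mulrA; [apply: WZ|apply: RE].
  by apply: RW; exact: subringPM.
move=> x Ex; apply: (WV); apply: E_gen x Ex => //; case: (Wring) => _ _ WM.
split=> // w Ww; have [->|w0] := eqVneq w 0;
  first by rewrite invr0 -(subrr 1); apply: WB.
have [k kP] := @cspan_dependent D hD Z Zdiv V (GRing.exp w)
  (fun i => WV _ (subringP_exp Wring i Ww)).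
apply: (cspan_pow_inv hD Zdiv Wring _ Ww w0 kP) => z Zz.
by rewrite -[z]mulr1; apply: WZ.
Qed.

Definition elem_op (L : seq (D * D)) (x : D) : D :=
  \sum_(t <- L) t.1 * x * t.2.

(** Induction on the number of terms. Scaled so that its first right factor is 1, the operator
    becomes [phi]; in [phi x * u - phi (x * u)] the first term cancels, so this shorter operator of
    finite rank vanishes. Hence [phi x = phi 1 * x], and [phi 1] must be 0, since otherwise [R]
    would lie in a finite-dimensional span. *)
Lemma finite_rank_elem_op (L : seq (D * D)) (V : seq D) :
  ~ finite_over_center ->
  (forall t, t \in L -> E t.1 /\ E t.2) -> (forall v, v \in V -> E v) ->
  (forall y, R y -> cspan Z V (elem_op L y)) ->
  forall y, R y -> elem_op L y = 0.
Proof.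
move=> infE; have [n] := ubnP (size L).
elim: n L V => // n IH [|[b c] L] V; first by move=> *;
  rewrite /elem_op big_nil.
rewrite ltnS /= => szL LE VE LV y Ry.
have LE' t : t \in L -> E t.1 /\ E t.2.
  by move=> Lt; apply: LE; rewrite inE Lt orbT.
have [Eb Ec] := LE _ (mem_head _ _).
have [c0|c0] := eqVneq c 0.
  have LE0 x : elem_op ((b, c) :: L) x = elem_op L x.
    by rewrite /elem_op big_cons c0 mulr0 add0r.
  by rewrite LE0; apply: (IH L V) => // x Rx; rewrite -LE0; apply: LV.
pose phi x := elem_op ((b, c) :: L) x * c^-1.
have phiM x u : R x -> R u -> phi x * u = phi (x * u).
  move=> Rx Ru; apply/eqP; rewrite -subr_eq0; apply/eqP.
  pose L' := [seq (t.1, t.2 * c^-1 * u - u * t.2 * c^-1) | t <- L].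
  have L'E w : phi w * u - phi (w * u) = elem_op L' w.
    rewrite /phi /elem_op !big_cons /= !mulrDl opprD addrACA.
    rewrite -!mulrA (mulrA c) !divring_mulrV // mul1r mulr1 subrr add0r.
    rewrite !mulr_suml -sumrB big_map; apply: eq_bigr => t _ /=.
    by rewrite mulrBr !mulrA.
  (* One half of [V'] receives the values [phi w * u], the other half the values [phi (w * u)]. *)
  rewrite L'E; pose V' :=
    [seq v * c^-1 * u | v <- V] ++ [seq v * c^-1 | v <- V].
  have V'1 v : cspan Z V v -> cspan Z V' (v * c^-1 * u).
    move=> /(cspan_mulr Zring (c^-1 * u)); rewrite mulrA;
      apply: cspan_trans => // w.
    move=> wV; apply: cspan_mem => //; rewrite mem_cat; apply/orP; left.
    by under eq_map do rewrite -mulrA.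
  have V'2 v : cspan Z V v -> cspan Z V' (v * c^-1).
    move=> /(cspan_mulr Zring c^-1); apply: cspan_trans => // w.
    by move=> wV; apply: cspan_mem => //; rewrite mem_cat wV orbT.
  apply: (IH L' V') => //; first by rewrite size_map.
  - move=> t /mapP[s /LE'[Es1 Es2] ->] /=; split=> //.
    by apply: subringPB => //; do ?[apply: subringPM => //]; auto.
  - move=> v; rewrite mem_cat => /orP[] /mapP[w /VE Ew ->];
      by do ?[apply: subringPM => //]; auto.
  - move=> w Rw; rewrite -L'E; apply: cspanB => //.
      by apply: V'1; apply: LV.
    by apply: V'2; apply: LV; apply: subringPM.
have phi1 x : R x -> phi x = phi 1 * x.
  by move=> Rx; rewrite phiM ?mul1r //; exact: subringP1.
have phiK x : elem_op ((b, c) :: L) x = phi x * c.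
  by rewrite /phi -mulrA divring_mulVr // mulr1.
have [phi0|phi0] := eqVneq (phi 1) 0.
  by rewrite phiK phi1 // phi0 !mul0r.
have Ephi : E (phi 1).
  apply: subringPM => //; last exact: EV.
  rewrite /elem_op big_seq; apply: subringP_sum => // t /LE[Et1 Et2].
  by rewrite mulr1; apply: subringPM.
case: infE; apply: (@finite_over_center_gen [seq (phi 1)^-1 * v | v <- [seq v
  * c^-1 | v <- V]]).
  move=> _ /mapP[_ /mapP[v /VE Ev ->] ->].
  by do ?[apply: subringPM => //]; auto.
move=> x Rx; have -> : x = (phi 1)^-1 * phi x.
  by rewrite (phi1 x) // mulrA divring_mulVr // mul1r.
apply: cspan_mull => // [z [Ez zC]|]; first by rewrite zC //; apply: EV.
by apply: cspan_mulr => //; apply: LV.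
Qed.

(** Scale to [a = 1]. If all left factors of [L] commute with [R], they are central and [x = 1]
    expresses [b]. Otherwise commuting with a suitable [u] gives a shorter relation, which puts one
    right factor in the span of the others; substituting it shortens the original relation. *)
Lemma elem_op_zero_span (L : seq (D * D)) a b :
  (forall t, t \in L -> E t.1) -> E a -> a != 0 ->
  (forall x, R x -> a * x * b + elem_op L x = 0) -> cspan Z (map snd L) b.
Proof.
have [n] := ubnP (size L); elim: n L a b => // n IH L a b.
rewrite ltnS => szL LE Ea a0 L0.
pose L1 := [seq (a^-1 * t.1, t.2) | t <- L].
have L10 x : R x -> x * b + elem_op L1 x = 0.
  move=> Rx; have /(congr1 ( *%R a^-1)) := L0 x Rx.
  rewrite mulr0 mulrDr !mulrA divring_mulVr // mul1r => <-; congr (_ + _).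
  rewrite /elem_op big_map mulr_sumr; apply: eq_bigr => t _ /=.
  by rewrite !mulrA.
have L1E t : t \in L1 -> E t.1.
  by move=> /mapP[s /LE Es ->]; apply: subringPM => //; apply: EV.
have -> : map snd L = map snd L1 by rewrite -map_comp.
have szL1 : (size L1 <= n)%N by rewrite size_map.
clearbody L1; move: L1 L10 L1E szL1 {L LE L0 szL a Ea a0} => L L0 LE szL.
have L0u u x : R u -> R x -> \sum_(t <- L) (u * t.1 - t.1 * u) * x * t.2 = 0.
  move=> Ru Rx; have eqL : u * elem_op L x = elem_op L (u * x).
    apply: (addrI (u * x * b)); rewrite (L0 (u * x)); last exact: subringPM.
    by rewrite -mulrA -mulrDr L0 // mulr0.
  transitivity (u * elem_op L x - elem_op L (u * x)); last by rewrite eqL subrr.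
  rewrite /elem_op mulr_sumr -sumrB; apply: eq_bigr => t _.
  by rewrite !mulrBl !mulrA.
have [comm|/existsNP[t /not_implyP[Lt]]] :=
    EM (forall t, t \in L -> forall u, R u -> u * t.1 = t.1 * u).
  have /eqP := L0 1 (subringP1 Rring); rewrite mul1r addr_eq0 => /eqP ->.
  rewrite -sub0r; apply: cspanB => //; first exact: cspan0.
  rewrite /elem_op big_seq; elim/big_rec: _ => [|t x Lt Lx];
    first exact: cspan0.
  apply: cspanD => //; rewrite mulr1; apply: cspanZ => //.
    by apply: center_of_gen; [exact: LE|exact: comm].
  by apply: cspan_mem => //; apply: map_f.
move=> /existsNP[u /not_implyP[Ru /eqP]]; rewrite -subr_eq0 => tu.
case/splitPr: L / Lt L0 LE szL L0u => L1 L2 L0 LE szL L0u.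
have Et : E t.1 by apply: LE; rewrite mem_cat mem_head orbT.
have LE' s : s \in L1 ++ L2 -> E s.1.
  by move=> Ls; apply: LE; move: Ls; rewrite !mem_cat inE => /orP[->|->] //;
    rewrite !orbT.
have szL' : (size (L1 ++ L2) < n)%N.
  by apply: leq_trans szL; rewrite !size_cat /= addnS.
have Lt : cspan Z (map snd (L1 ++ L2)) t.2.
  have <- : map snd [seq (u * s.1 - s.1 * u,
    s.2) | s <- L1 ++ L2] = map snd (L1 ++ L2).
    by rewrite -map_comp; apply: eq_map.
  apply: (IH _ (u * t.1 - t.1 * u)) => //; first by rewrite size_map.
  - move=> _ /mapP[s /LE' Es ->] /=.
    by apply: subringPB => //; apply: subringPM => //; apply: RE.
  - by apply: subringPB => //; apply: subringPM => //; apply: RE.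
  move=> x Rx; rewrite -[RHS](L0u u x Ru Rx) /elem_op big_map !big_cat
    big_cons /=.
  by rewrite addrCA.
have sub w : cspan Z (map snd (L1 ++ L2)) w ->
    cspan Z (map snd (L1 ++ t :: L2)) w.
  apply: cspan_trans => // v Lv; apply: cspan_mem => //; move: Lv.
  by rewrite !map_cat !mem_cat inE => /orP[->|->] //; rewrite !orbT.
apply: sub; have [c Zc tE] := (cspan_sumP Zring _ _).1 Lt.
set L' := L1 ++ L2 in Lt tE LE' szL' *.
(* The term [t] is absorbed by the others: the coordinates [c i] of [t.2] are central and move into
   the left factors. *)
pose L'' := [seq ((nth 0 L' i).1 + t.1 * c i,
  (nth 0 L' i).2) | i <- iota 0 (size L')].
have -> : map snd L' = map snd L''.
  by rewrite -map_comp -[in LHS](mkseq_nth 0 L') /mkseq -map_comp;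
    apply: eq_map.
apply: (IH L'' 1) => //.
- by rewrite size_map size_iota.
- move=> _ /mapP[i + ->]; rewrite mem_iota add0n => /andP[_ iL] /=.
  apply: subringPD => //; first by apply: LE'; apply: mem_nth.
  by apply: subringPM => //; case: (Zc i).
- exact: subringP1.
- exact: oner_neq0.
move=> x Rx; rewrite mul1r -[RHS](L0 x Rx); congr (_ + _).
have -> : elem_op (L1 ++ t :: L2) x = elem_op L' x + t.1 * x * t.2.
  by rewrite /elem_op !big_cat big_cons /= -addrA [X in _ + X]addrC.
rewrite tE /elem_op big_map [in RHS](big_nth 0) mulr_sumr size_map.
rewrite -(big_mkord xpredT (fun i => t.1 * x * (c i * (map snd L')`_i))).
rewrite /index_iota !subn0 -big_split; apply: eq_big_seq => i.
rewrite mem_iota add0n => /andP[_ iL] /=.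
rewrite !mulrDl; congr (_ + _); rewrite (nth_map 0) // -!mulrA; congr (_ * _).
by rewrite !mulrA (proj2 (Zc i)) //; apply: RE.
Qed.

(* Commuting the first slot with [u \in R] shortens the sum, so by induction
   [T(x, y) = \sum A x B y C] is left R-linear in [x]; then [T(1, y)] lies in
   the span of the fixed [c_j], and is a finite-rank elementary operator in
   [y]. *)
Lemma elem_op2_split (I : Type) (r : seq I) (g : I -> D -> D) (c : I -> D)
    (L : seq (D * D * D)) :
  ~ finite_over_center ->
  (forall t, t \in L -> [/\ E t.1.1, E t.1.2 & E t.2]) ->
  (forall j y, R y -> E (g j y)) -> (forall j, E (c j)) ->
  (forall x y, R x -> R y -> \sum_(t <- L) t.1.1 * x * t.1.2 * y * t.2 +
      \sum_(j <- r) g j y * x * c j = 0) ->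
  forall x y, R x -> R y -> \sum_(t <- L) t.1.1 * x * t.1.2 * y * t.2 = 0.
Proof.
move=> infE; have [n] := ubnP (size L).
elim: n L g => // n IH [|[[a b] d] L] g; first by move=> *; rewrite big_nil.
rewrite ltnS /= => szL LE gE cE L0 x0 y0 Rx0 Ry0.
have LE' t : t \in L -> [/\ E t.1.1, E t.1.2 & E t.2].
  by move=> Lt; apply: LE; rewrite inE Lt orbT.
have [/= Ea Eb Ed] := LE _ (mem_head _ _).
have [a0|a0] := eqVneq a 0.
  rewrite big_cons /= a0 !mul0r add0r; apply: (IH L g) => // x y Rx Ry.
  by rewrite -[RHS](L0 x y Rx Ry) big_cons /= a0 !mul0r add0r.
pose L1 := [seq (a^-1 * t.1.1, t.1.2, t.2) | t <- (a, b, d) :: L].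
pose T x y := \sum_(t <- L1) t.1.1 * x * t.1.2 * y * t.2.
have TE x y : \sum_(t <- (a, b,
  d) :: L) t.1.1 * x * t.1.2 * y * t.2 = a * T x y.
  rewrite /T big_map mulr_sumr; apply: eq_bigr => t _ /=.
  by rewrite !mulrA divring_mulrV // mul1r.
have T0 x y : R x -> R y -> T x y + \sum_(j <- r) (a^-1 * g j y) * x * c j = 0.
  move=> Rx Ry; apply: (divring_mulrI hD a0);
    rewrite mulrDr -TE -[RHS](L0 x y Rx Ry).
  congr (_ + _); rewrite mulr_sumr; apply: eq_bigr => j _.
  by rewrite !mulrA divring_mulrV // mul1r.
have L1E t : t \in L1 -> [/\ E t.1.1, E t.1.2 & E t.2].
  move=> /mapP[s /LE[Es1 Es2 Es3] ->] /=; split=> //.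
  by apply: subringPM => //; apply: EV.
have Tlin u x y : R u -> R x -> R y -> u * T x y = T (u * x) y.
  move=> Ru Rx Ry; apply/eqP; rewrite -subr_eq0; apply/eqP.
  pose L2 := [seq (u * (a^-1 * t.1.1) - a^-1 * t.1.1 * u, t.1.2, t.2) | t <- L].
  have L2E x' y' :
      u * T x' y' - T (u * x') y' = \sum_(t <- L2) t.1.1 * x' * t.1.2 * y' *
        t.2.
    rewrite /T !big_cons /= divring_mulVr // mulrDr opprD addrACA.
    rewrite !mul1r !mulrA subrr add0r mulr_sumr !big_map -sumrB.
    by apply: eq_bigr => t _ /=; rewrite !mulrBl !mulrA.
  rewrite L2E.
  apply: (IH L2 (fun j y => u * (a^-1 * g j y) - a^-1 * g j y * u)) => //.
  - by rewrite size_map.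
  - move=> _ /mapP[s /LE'[Es1 Es2 Es3] ->] /=; split=> //.
    by apply: subringPB => //; do ?[apply: subringPM => //]; auto.
  - move=> j y' Ry'.
    by apply: subringPB => //; do ?[apply: subringPM => //]; auto.
  move=> x' y' Rx' Ry'; rewrite -L2E.
  have Rux := subringPM Rring Ru Rx'.
  have -> : \sum_(j <- r) (u * (a^-1 * g j y') - a^-1 * g j y' * u) * x' * c j
     = u * (\sum_(j <- r) (a^-1 * g j y') * x' * c j) -
       \sum_(j <- r) (a^-1 * g j y') * (u * x') * c j.
    rewrite mulr_sumr -sumrB; apply: eq_bigr => j _.
    by rewrite !mulrBl !mulrA.
  by rewrite addrACA -mulrDr -opprD !T0 // mulr0 subrr.
have T1 x y : R x -> R y -> T x y = x * T 1 y.
  by move=> Rx Ry; rewrite Tlin ?mulr1 //; exact: subringP1.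
pose K := [seq (t.1.1 * t.1.2, t.2) | t <- L1].
have KE y : T 1 y = elem_op K y.
  by rewrite /elem_op big_map; apply: eq_bigr => t _ /=; rewrite mulr1.
rewrite TE T1 // KE (@finite_rank_elem_op K (map c r)) ?mulr0 //.
- move=> _ /mapP[s /L1E[Es1 Es2 Es3] ->] /=; split=> //.
  exact: subringPM.
- elim: (r) => //= j r' IHr v; rewrite inE => /orP[/eqP->|] //; exact: IHr.
move=> y Ry; rewrite -KE.
have -> : map c r = map snd [seq (a^-1 * g j y,
  c j) | j <- r] by rewrite -map_comp.
(* For fixed [y], the term [x * T 1 y] plus an operator in [x] with right factors [c j] vanishes on
   all of [R]. *)
apply: (elem_op_zero_span (a := 1)) => //.
- elim: (r) => //= j r' IHr v; rewrite inE => /orP[/eqP->|] /=; last exact: IHr.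
  by apply: subringPM; auto.
- exact: subringP1.
- exact: oner_neq0.
by move=> x Rx; rewrite mul1r -T1 // /elem_op big_map; exact: T0.
Qed.

End Generation.

(** * Multilinear identities *)

Section Words.
Variable T : eqType.
Implicit Types (i j : T) (s : seq T).

Definition before i s := take (index i s) s.
Definition after i s := drop (index i s).+1 s.

Lemma cat_before_after i s : i \in s -> before i s ++ i :: after i s = s.
Proof.
by move=> si; rewrite /before /after -{2}(nth_index i si) -drop_nth ?index_mem
  // cat_take_drop.
Qed.

Lemma mem_after i j s :
  i \in s -> j \in s -> (index i s < index j s)%N -> j \in after i s.
Proof.
move=> si sj ij; have ji : j != i by apply: contraTneq ij => ->; rewrite ltnn.
move: (sj); rewrite -{1}(cat_before_after si) mem_cat inE (negPf ji) /=.
case/orP=> // jb; move: ij.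
rewrite -{2}(cat_before_after si) index_cat jb ltnNge; case/negP.
by apply: leq_trans (index_size _ _) _; rewrite size_take_min geq_minl.
Qed.

(** At the first position where the words differ, the two letters found there occur in opposite
    orders in [s] and [s']. *)
Lemma perm_neq_inversion s s' : uniq s -> perm_eq s s' -> s != s' ->
  exists i j, [/\ i \in s, j \in s, (index i s < index j s)%N &
    (index j s' < index i s')%N].
Proof.
elim: s s' => [|x s IH] [|y s'] //.
- by move=> _ /perm_size.
- by move=> _ /perm_size.
rewrite cons_uniq => /andP[xs us]; have [<-|xy] := eqVneq x y.
  rewrite perm_cons => pss' ss'.
  have {}ss' : s != s' by apply: contraNneq ss' => ->.
  have [i [j [si sj ij ji]]] := IH s' us pss' ss'.
  have xi : x != i by apply: contraNneq xs => ->.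
  have xj : x != j by apply: contraNneq xs => ->.
  by exists i, j; split; rewrite /= ?inE ?si ?sj ?orbT ?(negPf xi) ?(negPf xj).
move=> pss' _; exists x, y; split; rewrite /= ?mem_head ?eqxx ?(negPf xy) //.
  by rewrite (perm_mem pss') mem_head.
by rewrite eq_sym (negPf xy).
Qed.

Variable D : unitRingType.

(** Since letters do not repeat, the three remaining segments avoid [i] and [j], so the product is
    visibly bilinear in [b i] and [b j]. *)
Lemma prod_word_split i j s (a b : T -> D) : uniq s -> i \in s -> j \in s ->
  (index i s < index j s)%N -> (forall k, k != i -> k != j -> b k = a k) ->
  \prod_(k <- s) b k = \prod_(k <- before i s) a k * b i *
    \prod_(k <- before j (after i s)) a k * b j *
    \prod_(k <- after j (after i s)) a k.
Proof.
move=> us si sj ij ba; have sj' := mem_after si sj ij.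
have eqab s' : i \notin s' -> j \notin s' ->
    \prod_(k <- s') b k = \prod_(k <- s') a k.
  move=> is' js'; apply: eq_big_seq => k s'k; apply: ba.
    by apply: contraNneq is' => <-.
  by apply: contraNneq js' => <-.
rewrite -{1}(cat_before_after si) big_cat big_cons /=.
rewrite -{1}(cat_before_after sj') big_cat big_cons /=.
have : uniq (before i s ++ i :: before j (after i s) ++ j :: after j (after i
  s)).
  by rewrite cat_before_after // cat_before_after.
rewrite cat_uniq /= cat_uniq /= has_cat /= !mem_cat !inE !negb_or.
case/and5P=> _ /and4P[i1 _ j1 _] /and3P[i2 _ i3] _ /and3P[/andP[j2 _] j3 _].
by rewrite !eqab // !mulrA.
Qed.

End Words.

Section MultilinearIdentity.
Variable D : unitRingType.
Hypothesis hD : is_division_ring D.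
Variables E R : D -> Prop.
Hypothesis Ediv : divring_closedP E.
Hypothesis Rring : subringP R.
Hypothesis RE : forall x, R x -> E x.
Hypothesis E_gen : forall P : D -> Prop,
  divring_closedP P -> (forall x, R x -> P x) -> forall x, E x -> P x.
Let Ering := divring_subringP Ediv.

(* Two distinct words disagree on the order of two letters [i], [j]; viewing the
   identity as a bilinear function of [x_i] and [x_j], the words with [i] before
   [j] form an identity of their own. *)
Lemma no_multilinear_identity (T : eqType) (L : seq (seq T)) (s0 : seq T)
    (c : seq T -> D) :
  ~ finite_over_center E -> uniq L -> uniq s0 ->
  (forall s, s \in L -> perm_eq s s0) ->
  (forall s, E (c s)) -> (forall s, s \in L -> c s != 0) ->
  (forall a : T -> D, (forall i, R (a i)) ->
     \sum_(s <- L) c s * \prod_(i <- s) a i = 0) ->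
  L = [::].
Proof.
move=> infE + us0; have [n] := ubnP (size L); elim: n L => // n IH [//|s L].
rewrite ltnS => szL uL Ls0 Ec c0 L0; have Ls : s \in s :: L := mem_head _ _.
case: L szL uL Ls0 c0 L0 Ls => [|s' L] szL uL Ls0 c0 L0 Ls.
  (* With a single word left, setting every variable to 1 returns its nonzero coefficient. *)
  have := L0 (fun=> 1) (fun=> subringP1 Rring).
  by rewrite big_seq1 big1_eq mulr1 => /eqP; rewrite (negPf (c0 s Ls)).
have Ls' : s' \in [:: s, s' & L] by rewrite !inE eqxx orbT.
have us t : t \in [:: s, s' & L] -> uniq t by move=> /Ls0/perm_uniq ->.
have ss' : s != s' by case/andP: uL; rewrite inE negb_or => /andP[].
have pss' : perm_eq s s'.
  by apply: (perm_trans (Ls0 s Ls)); rewrite perm_sym; apply: Ls0.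
have [i [j [si sj ij ji]]] := perm_neq_inversion (us s Ls) pss' ss'.
have mem0 t k : k \in s -> t \in [:: s, s' & L] -> k \in t.
  by move=> sk /Ls0 pt; rewrite (perm_mem pt) -(perm_mem (Ls0 s Ls)).
have neij : i != j by apply: contraTneq ij => ->; rewrite ltnn.
set M := [:: s, s' & L] in uL Ls0 c0 L0 Ls Ls' us szL mem0.
clearbody M.
pose q t := (index i t < index j t)%N.
(* The word [s'] has [j] before [i], so the filter discards it and the induction applies. *)
have szM : (size [seq t <- M | q t] < size M)%N.
  rewrite size_filter -(count_predC q M) -[X in (X < _)%N]addn0 ltn_add2l.
  by rewrite -has_count; apply/hasP; exists s' => //=; rewrite /q -leqNgt ltnW.
have : [seq t <- M | q t] = [::].
  apply: IH => //.
  - by apply: leq_trans szM szL.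
  - exact: filter_uniq.
  - by move=> t; rewrite mem_filter => /andP[_]; exact: Ls0.
  - by move=> t; rewrite mem_filter => /andP[_]; exact: c0.
  move=> a Ra; pose P u := \prod_(k <- u) a k.
  have EP u : E (P u) by apply: subringP_prod => // k _; apply: RE.
  pose K := [seq (c t * P (before i t), P (before j (after i t)),
                  P (after j (after i t))) | t <- [seq t <- M | q t]].
  (* For words with [j] before [i], [g t y] collects everything left of the variable [x_i],
     including [y]; the tail [d t] depends on neither variable. *)
  pose g t y := c t * P (before j t) * y * P (before i (after j t)).
  pose d t := P (after i (after j t)).
  have := @elem_op2_split D hD E R Ediv Rring RE E_gen _
    [seq t <- M | ~~ q t] g d K infE.
  have KE b : (forall k, k != i -> k != j -> b k = a k) ->
      \sum_(t <- K) t.1.1 * b i * t.1.2 * b j * t.2 =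
      \sum_(t <- [seq t <- M | q t]) c t * \prod_(k <- t) b k.
    move=> ba; rewrite big_map; apply: eq_big_seq => t.
    rewrite mem_filter => /andP[qt Mt] /=.
    rewrite (prod_word_split (us t Mt) (mem0 t i si Mt) (mem0 t j sj Mt) qt ba).
    by rewrite /P !mulrA.
  move=> splitK; rewrite -KE //; apply: splitK => //.
  - move=> _ /mapP[t _ ->] /=; split=> //; exact: subringPM.
  - move=> t y /RE Ey; rewrite /g; do ?[apply: subringPM => //]; exact: EP.
  - by move=> t; exact: EP.
  move=> x y Rx Ry.
  pose b k := if k == i then x else if k == j then y else a k.
  have bi : b i = x by rewrite /b eqxx.
  have bj : b j = y by rewrite /b eqxx eq_sym (negPf neij).
  have ba k : k != i -> k != j -> b k = a k.
    by rewrite /b => /negPf-> /negPf->.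
  rewrite -{1}bi -{1}bj KE // big_filter -[RHS](L0 b); last first.
    by move=> k; rewrite /b; case: ifP => // _; case: ifP.
  rewrite [RHS](bigID q) /=; congr (_ + _).
  rewrite big_filter_cond big_seq_cond [RHS]big_seq_cond.
  apply: eq_big => [t|t /andP[Mt qt]]; first by rewrite andbT.
  have {}qt : (index j t < index i t)%N.
    rewrite andbT /q -leqNgt leq_eqVlt in qt; case/orP: qt => // /eqP ejit.
    have ti := mem0 t i si Mt; have tj := mem0 t j sj Mt.
    by case/eqP: neij; rewrite -(nth_index i ti) -ejit nth_index.
  rewrite (prod_word_split (us t Mt) (mem0 t j sj Mt) (mem0 t i si Mt) qt
    (fun k kj ki => ba k ki kj)).
  by rewrite /g /d /P bi bj !mulrA.
(* The word [s] passes the filter, so the filtered list cannot be empty. *)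
by move=> /(congr1 (fun M => s \in M)); rewrite mem_filter Ls /q ij.
Qed.

End MultilinearIdentity.

(** * The standard identity *)

Section StandardIdentity.
Variable D : unitRingType.

Lemma prod_enum_ord n (F : 'I_n -> D) :
  \prod_(i <- enum 'I_n) F i = \prod_(i < n) F i.
Proof. by rewrite enumT [index_enum _]unlock. Qed.

Definition std_word n (s : 'S_n) : seq nat := [seq val (s i) | i <- enum 'I_n].

Definition std_poly n : ncpoly D :=
  [seq ((-1) ^+ odd_perm s, std_word s) | s <- enum [set: 'S_n]].

Lemma std_word_inj n : injective (@std_word n).
Proof.
move=> s t st; apply/permP => i; apply: val_inj.
have nthE (u : 'S_n) : nth 0%N (std_word u) i = u i.
  by rewrite (nth_map i) ?size_enum_ord // nth_ord_enum.
by rewrite /= -!nthE st.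
Qed.

Lemma std_poly_sign n (t : D * seq nat) :
  t \in std_poly n -> t.1 = 1 \/ t.1 = -1.
Proof.
by case/mapP=> s _ -> /=; case: (odd_perm s); [right|left].
Qed.

Lemma std_poly_nonzero n : ncpoly_nonzero (std_poly n).
Proof.
(* By injectivity of [std_word], only the identity permutation produces this word, so its
   coefficient is 1. *)
exists (@std_word n 1%g); rewrite big_map big_enum_cond /= (big_pred1 1%g).
  by rewrite odd_perm1 oner_neq0.
by move=> s /=; rewrite inE /= (inj_eq (@std_word_inj n)).
Qed.

Lemma std_poly_eval n (a : nat -> D) : ncpoly_eval (std_poly n) a =
  \sum_(s : 'S_n) (-1) ^+ s * \prod_(i < n) a (s i).
Proof.
rewrite /ncpoly_eval big_map big_enum; apply: eq_big => [s|s _];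
  first by rewrite inE.
by rewrite /= /std_word big_map prod_enum_ord.
Qed.

(** Composing [s] with the transposition of [i1] and [i2] flips the sign and preserves the product,
    so the terms cancel in pairs. *)
Lemma alternating_sum_eq0 n (b : 'I_n -> D) (i1 i2 : 'I_n) :
  i1 != i2 -> b i1 = b i2 ->
  \sum_(s : 'S_n) (-1) ^+ s * \prod_(i < n) b (s i) = 0.
Proof.
move=> neq_i12 eqb12; pose t := tperm i1 i2.
have oddMt (s : 'S_n) : (s * t)%g = ~~ s :> bool.
  by rewrite odd_permM odd_tperm neq_i12 addbT.
rewrite (bigID (@odd_perm _)) /=.
apply: canLR (subrK _) _; rewrite add0r -sumrN.
rewrite (reindex_inj (mulIg t)); apply: eq_big => //= s.
rewrite oddMt => /negPf->; rewrite mulN1r mul1r; congr (- _).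
apply: eq_bigr => /= i _.
by rewrite permM /t; case: tpermP => // ->.
Qed.

Lemma prod_commuting (I : Type) (r : seq I) (c b : I -> D) :
  (forall i j, c i * b j = b j * c i) ->
  \prod_(i <- r) (c i * b i) = \prod_(i <- r) c i * \prod_(i <- r) b i.
Proof.
move=> cb; elim: r => [|i r IH]; first by rewrite !big_nil mulr1.
rewrite !big_cons IH -!mulrA; congr (_ * _); rewrite !mulrA; congr (_ * _).
elim: r {IH} => [|j r IH]; first by rewrite !big_nil mulr1 mul1r.
by rewrite !big_cons mulrA -cb -!mulrA IH.
Qed.

Lemma prod_commuting_perm (I : eqType) (r r' : seq I) (c : I -> D) :
  (forall i j, c i * c j = c j * c i) -> perm_eq r r' ->
  \prod_(i <- r) c i = \prod_(i <- r') c i.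
Proof.
move=> cc; elim: r r' => [|i r IH] r' rr'.
  by move/perm_size/esym/size0nil: rr' => ->.
have ir' : i \in r' by rewrite -(perm_mem rr') mem_head.
case/splitPr: ir' rr' => r1 r2.
rewrite perm_sym -[i :: r2]cat1s perm_catCA perm_cons perm_sym => /IH rr'.
rewrite big_cons rr' !big_cat big_cons /= !mulrA; congr (_ * _).
by rewrite big_nil mulr1; apply: commr_prod => j _; apply: cc.
Qed.

Variables (C : D -> Prop) (V : seq D).
Hypothesis Cring : subringP C.
Hypothesis CC : forall x y, C x -> C y -> x * y = y * x.
Hypothesis CV : forall x v, C x -> v \in V -> x * v = v * x.

(** The coefficients commute with each other and with [V], so multilinear expansion reduces the
    value to standard polynomials in elements of [V]. With one more argument than generators, some
    generator repeats and each of these vanishes. *)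
Lemma std_poly_cspan (a : nat -> D) :
  (forall i, cspan C V (a i)) -> ncpoly_eval (std_poly (size V).+1) a = 0.
Proof.
move=> aV; set n := size V; rewrite std_poly_eval.
have /choice[c cP] i : exists c : nat -> D,
    (forall j, C (c j)) /\ a i = \sum_(j < n) c j * V`_j.
  by have [c Cc ->] := (cspan_sumP Cring _ _).1 (aV i); exists c.
pose m (f : {ffun 'I_n.+1 -> 'I_n}) := \prod_(i < n.+1) c i (f i).
transitivity (\sum_(f : {ffun 'I_n.+1 -> 'I_n}) m f *
   (\sum_(s : 'S_n.+1) (-1) ^+ s * \prod_(i < n.+1) V`_(f (s i)))); last first.
  apply: big1 => f _.
  have /injectivePn[i [j ij fij]] : ~~ injectiveb f.
    apply/injectiveP => /leq_card; rewrite !card_ord.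
    by rewrite ltnn.
  by rewrite (@alternating_sum_eq0 _ (fun i => V`_(f i)) i j) ?fij // mulr0.
under [RHS]eq_bigr do rewrite mulr_sumr.
rewrite exchange_big; apply: eq_bigr => s _.
have -> : \prod_(i < n.+1) a (s i) =
    \prod_(i < n.+1) \sum_(j < n) c (s i) j * V`_j.
  by apply: eq_bigr => i _; rewrite (cP _).2.
rewrite bigA_distr_bigA mulr_sumr.
(* Replacing [f] by its composite with [s] turns the coefficient into a reordering of [m f], hence
   independent of [s]. *)
rewrite (reindex_inj (h := fun f : {ffun 'I_n.+1 -> 'I_n} => [ffun i =>
  f (s i)])).
  apply: eq_bigr => f _; rewrite mulrA.
  have -> : m f * (-1) ^+ s = (-1) ^+ s * m f.
    by case: (odd_perm s); rewrite ?expr1 ?expr0 ?mulrN1 ?mulN1r ?mulr1 ?mul1r.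
  rewrite -mulrA; congr (_ * _).
  under [LHS]eq_bigr do rewrite ffunE.
  rewrite prod_commuting; last first.
    by move=> i j; apply: CV; [exact: (cP _).1|apply: mem_nth].
  congr (_ * _); rewrite /m.
  have := @prod_commuting_perm _ [seq s i | i <- enum 'I_n.+1] (enum 'I_n.+1)
    (fun i => c i (f i)).
  rewrite big_map !prod_enum_ord; apply.
    by move=> i j; apply: CC; exact: (cP _).1.
  apply: uniq_perm.
  - by rewrite (map_inj_uniq (@perm_inj _ s)) enum_uniq.
  - exact: enum_uniq.
  - move=> i; rewrite mem_enum; apply/mapP.
    by exists (s^-1%g i); [rewrite mem_enum|rewrite permKV].
move=> f g /ffunP fg; apply/ffunP => i.
by have := fg (s^-1%g i); rewrite !ffunE permKV.
Qed.

End StandardIdentity.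

(** * Linearization *)

Section Linearization.
Variable D : unitRingType.

Fixpoint words_of (T : eqType) (J : seq T) n : seq (seq T) :=
  if n is n'.+1 then [seq j :: s | j <- J, s <- words_of J n'] else [:: [::]].

Lemma mem_words_of (T : finType) n (s : seq T) :
  (s \in words_of (enum T) n) = (size s == n).
Proof.
elim: n s => [|n IH] [|j s] //=.
  by apply/negP => /allpairsP[[j s] []].
rewrite eqSS -IH; apply/allpairsP/idP => [[[i t] /= [_ tn [_ ->]]] //|sn].
by exists (j, s); rewrite mem_enum.
Qed.

Lemma uniq_words_of (T : eqType) (J : seq T) n :
  uniq J -> uniq (words_of J n).
Proof.
move=> uJ; elim: n => //= n IH; apply: allpairs_uniq => //.
by move=> [i s] [j t] _ _ [-> ->].
Qed.

Lemma prod_sum_words (T U : eqType) (J : seq T) (u : seq U) (F : U -> T -> D) :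
  \prod_(i <- u) \sum_(j <- J) F i j =
  \sum_(s <- words_of J (size u)) \prod_(p <- zip u s) F p.1 p.2.
Proof.
elim: u => [|i u IH]; first by rewrite big_nil big_seq1 big_nil.
rewrite big_cons IH big_allpairs_dep mulr_suml; apply: eq_bigr => j _.
by rewrite mulr_sumr; apply: eq_bigr => s _; rewrite big_cons.
Qed.

(** Used when the sum of the [x j] with [B j] and [w j = i] replaces each letter [i] of [u]: the
    surviving words [s] are those over [B] that [w] maps to [u]. *)
Lemma prod_zip_indicator (T : Type) (u : seq nat) (s : seq T) (x : T -> D)
    (B : T -> bool) (w : T -> nat) : size s = size u ->
  \prod_(p <- zip u s) (x p.2 *+ (B p.2 && (w p.2 == p.1))) =
  (\prod_(j <- s) x j) *+ (all B s && (map w s == u)).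
Proof.
elim: u s => [|i u IH] [|j s] //=; first by rewrite !big_nil.
case=> /IH{}IH; rewrite !big_cons IH /= eqseq_cons.
rewrite mulrnAl mulrnAr -mulrnA mulnb.
by congr (_ *+ nat_of_bool _);
  case: (B j) (all B s) (w j == i) (map w s == u) => [] [] [] [].
Qed.

(* Inclusion-exclusion over the sets [B] of letters. *)
Lemma sum_sign_all d (s : seq 'I_d) :
  \sum_(B : {ffun 'I_d -> bool})
    (\prod_(j < d) (if B j then 1 else -1 : int)) * (all B s : nat)%:Z =
  (\prod_(j < d) (j \in s : nat))%N%:Z.
Proof.
have allE (B : {ffun 'I_d -> bool}) :
    (all B s : nat)%:Z = \prod_(j < d) (((j \in s) ==> B j) : nat)%:Z.
  have [Bs|] := boolP (all B s).
    rewrite big1 // => j _; case: (boolP (j \in s)) => //= sj.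
    by rewrite (allP Bs).
  case/allPn=> j sj Bj; rewrite (bigD1 j) //= sj (negPf Bj) /=.
  by rewrite mul0r.
under eq_bigr do rewrite allE -big_split /=.
rewrite -(bigA_distr_bigA (fun (j : 'I_d) (b : bool) =>
  (if b then 1 else -1 : int) * (((j \in s) ==> b) : nat)%:Z)).
rewrite -[RHS]natz natr_prod; apply: eq_bigr => j _.
by rewrite big_bool /=; case: (j \in s).
Qed.

Definition ncpoly_coef (p : ncpoly D) (w : seq nat) : D :=
  \sum_(t <- p | t.2 == w) t.1.

(** A formal sum may list the same word several times; collecting these terms brings in the true
    coefficients. *)
Lemma ncpoly_evalE (p : ncpoly D) (a : nat -> D) : ncpoly_eval p a =
  \sum_(u <- undup (map snd p)) ncpoly_coef p u * \prod_(i <- u) a i.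
Proof.
rewrite /ncpoly_coef; under [RHS]eq_bigr do rewrite mulr_suml.
rewrite (exchange_big_dep xpredT) //= /ncpoly_eval; apply: eq_big_seq => t pt.
have Ut : t.2 \in undup (map snd p) by rewrite mem_undup map_f.
rewrite -[RHS]big_filter (bigD1_seq t.2) ?filter_uniq ?undup_uniq //=;
  last first.
  by rewrite mem_filter eqxx.
rewrite big_filter_cond [X in _ + X]big1 ?addr0 // => u /andP[/eqP ->].
by rewrite eqxx.
Qed.

Lemma ncpoly_coef_notin (p : ncpoly D) u :
  u \notin map snd p -> ncpoly_coef p u = 0.
Proof.
move=> pu; rewrite /ncpoly_coef big_seq_cond big1 // => t /andP[pt /eqP tu].
by rewrite -tu map_f in pu.
Qed.

Lemma ncpoly_max_word (p : ncpoly D) : ncpoly_nonzero p ->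
  exists2 w, ncpoly_coef p w != 0 &
    forall u, ncpoly_coef p u != 0 -> (size u <= size w)%N.
Proof.
move=> [w0 pw0]; pose P n := has (fun u =>
  (ncpoly_coef p u != 0) && (size u == n)) (map snd p).
have PE u : ncpoly_coef p u != 0 -> P (size u).
  move=> pu; apply/hasP; exists u; last by rewrite pu eqxx.
  by apply: contraNT pu => /ncpoly_coef_notin ->.
have exP : exists n, P n by exists (size w0); apply: PE.
have ubP n : P n -> (n <= \max_(u <- map snd p) size u)%N.
  by case/hasP=> u pu /andP[_ /eqP <-]; apply: leq_bigmax_seq.
case: (ex_maxnP exP ubP) => n /hasP[w _ /andP[pw /eqP <-]] maxn.
by exists w => // u /PE /maxn.
Qed.

Section Identity.
Variables (R : D -> Prop) (p : ncpoly D) (w : seq nat).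
Hypothesis Rring : subringP R.
Hypothesis p0 : forall a : nat -> D, (forall i, R (a i)) -> ncpoly_eval p a = 0.
Hypothesis wmax : forall u, ncpoly_coef p u != 0 -> (size u <= size w)%N.
Let d := size w.
Let wf (j : 'I_d) := nth 0%N w j.

(* The multilinear part of [p] under the substitution of [\sum_(w_j = i) x_j]
   for the variable [i]; since [size w] is maximal, only words of length [d]
   contribute, each letter [x_j] occurring once. *)
Lemma multilinearization (x : 'I_d -> D) : (forall j, R (x j)) ->
  \sum_(s <- permutations (enum 'I_d)) ncpoly_coef p (map wf s) *
    \prod_(j <- s) x j = 0.
Proof.
(* [e B] is -1 to the number of letters omitted from [B], the inclusion-exclusion sign. *)
move=> Rx; pose e (B : {ffun 'I_d -> bool}) :=
  \prod_(j < d) (if B j then 1 else -1 : int).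
pose a (B : {ffun 'I_d -> bool}) i :=
  \sum_(j <- enum 'I_d) x j *+ (B j && (wf j == i)).
transitivity (\sum_(B : {ffun 'I_d -> bool}) ncpoly_eval p (a B) *~ e B);
  last first.
  apply: big1 => B _; rewrite p0 ?mul0rz // => i.
  apply: subringP_sum => // j _; case: (_ && _); rewrite ?mulr1n ?mulr0n //.
  exact: subringP0.
under [RHS]eq_bigr do rewrite ncpoly_evalE mulrz_suml.
rewrite exchange_big /=.
have step u : u \in undup (map snd p) ->
    \sum_(B : {ffun 'I_d ->
      bool}) (ncpoly_coef p u * \prod_(i <- u) a B i) *~ e B =
    \sum_(s <- permutations (enum 'I_d) | map wf s == u)
      ncpoly_coef p (map wf s) * \prod_(j <- s) x j.
  move=> _; have [u0|u0] := eqVneq (ncpoly_coef p u) 0.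
    rewrite big1 => [|B _]; last by rewrite u0 mul0r mul0rz.
    by rewrite big1 // => s /eqP ->; rewrite u0 mul0r.
  under eq_bigr => B _.
    rewrite /a prod_sum_words -mulrzAr mulrz_suml.
    under eq_big_seq => s.
      rewrite mem_words_of => /eqP szs.
      rewrite prod_zip_indicator // pmulrn -mulrzA.
      over.
    over.
  rewrite -mulr_sumr exchange_big /=.
  transitivity (ncpoly_coef p u * \sum_(s <- permutations (enum 'I_d) | map wf
    s == u)
       \prod_(j <- s) x j); last first.
    by rewrite mulr_sumr; apply: eq_bigr => s /eqP ->.
  congr (_ * _).
  (* The signed sum over [B] removes every word that misses a letter. *)
  transitivity (\sum_(s <- words_of (enum 'I_d) (size u) |
      (map wf s == u) && [forall j, j \in s]) \prod_(j <- s) x j).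
    rewrite [RHS]big_mkcond; apply: eq_bigr => s _; rewrite -mulrz_sumr.
    have -> : \sum_(B : {ffun 'I_d -> bool})
        (all B s && (map wf s == u) : nat)%:Z * e B =
        ((map wf s == u) * \prod_(j < d) (j \in s : nat))%N%:Z.
      rewrite PoszM -sum_sign_all mulr_sumr; apply: eq_bigr => B _.
      by rewrite -mulnb PoszM mulrAC [RHS]mulrC; congr (_ * _); rewrite mulrC.
    rewrite -pmulrn; case: (map wf s == u) => /=; last by rewrite mul0n.
    have [sT|] := boolP [forall j, j \in s].
      rewrite (_ : \prod_(j < d) _ = 1%N)%N ?mul1n //.
      by apply: big1 => j _; rewrite (forallP sT).
    rewrite negb_forall => /existsP[j sj].
    by rewrite (_ : \prod_(j < d) _ = 0%N)%N ?mul1n // (bigD1 j) //= (negPf sj).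
  rewrite -[LHS]big_filter -[RHS]big_filter; apply: perm_big; apply: uniq_perm.
  - by rewrite filter_uniq // uniq_words_of // enum_uniq.
  - by rewrite filter_uniq // permutations_uniq.
  move=> s; rewrite !mem_filter mem_words_of mem_permutations.
  have [su|//] := eqVneq (map wf s) u; rewrite /=.
  have szs : size s = size u by rewrite -su size_map.
  rewrite szs eqxx andbT; apply/forallP/idP => [sT|ps j].
    (* Maximality of [w] enters here: a word containing all [d] letters and of length at most [d]
       has no repetition. *)
    have sub : {subset enum 'I_d <= s} by move=> j _; apply: sT.
    have szd : (size s <= size (enum 'I_d))%N by rewrite size_enum_ord szs wmax.
    have us := leq_size_uniq (enum_uniq 'I_d) sub szd.
    apply: uniq_perm => //; first exact: enum_uniq.
    by move=> j; rewrite sT mem_enum.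
  by rewrite (perm_mem ps) mem_enum.
rewrite (eq_big_seq _ step) (exchange_big_dep xpredT) //=;
  apply: eq_bigr => s _.
have [ps|ps] := boolP (map wf s \in map snd p); last first.
  by rewrite ncpoly_coef_notin // mul0r big1 // => u _; rewrite mul0r.
rewrite -[RHS]big_filter (bigD1_seq (map wf s)) ?filter_uniq ?undup_uniq //=;
  last first.
  by rewrite mem_filter eqxx mem_undup.
rewrite big_filter_cond [X in _ + X]big1 ?addr0 // => u /andP[/eqP ->].
by rewrite eqxx.
Qed.

(** The positions in their natural order thus carry the coefficient of [w] itself, which keeps the
    multilinear identity nonzero. *)
Lemma map_wf_enum : map wf (enum 'I_d) = w.
Proof.
by rewrite /wf (map_comp (nth 0%N w) val) val_enum_ord -/(mkseq _ _) mkseq_nth.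
Qed.

End Identity.
End Linearization.

(** * Kaplansky's theorem for a subring generating a division ring *)

Section Kaplansky.
Variable D : unitRingType.
Hypothesis hD : is_division_ring D.
Variables E R : D -> Prop.
Hypothesis Ediv : divring_closedP E.
Hypothesis Rring : subringP R.
Hypothesis RE : forall x, R x -> E x.
Hypothesis E_gen : forall P : D -> Prop,
  divring_closedP P -> (forall x, R x -> P x) -> forall x, E x -> P x.

Theorem PI_finite_over_center (p : ncpoly D) :
  (forall t, t \in p -> E t.1) -> ncpoly_nonzero p ->
  (forall a : nat -> D, (forall i, R (a i)) -> ncpoly_eval p a = 0) ->
  finite_over_center E.
Proof.
move=> pE /ncpoly_max_word[w w0 wmax] p0; apply: contrapT => infE.
have Ering := divring_subringP Ediv.
pose c (s : seq 'I_(size w)) := ncpoly_coef p [seq nth 0%N w (val j) | j <- s].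
have := @no_multilinear_identity D hD E R Ediv Rring RE E_gen _
  [seq s <- permutations (enum 'I_(size w)) | c s != 0] (enum 'I_(size w)) c
    infE.
have Lw : enum 'I_(size w) \in
    [seq s <- permutations (enum 'I_(size w)) | c s != 0].
  by rewrite mem_filter mem_permutations perm_refl andbT /c map_wf_enum.
move=> noL; suff Lnil :
  [seq s <- permutations (enum 'I_(size w)) | c s != 0] = [::].
  by rewrite Lnil in Lw.
apply: noL.
- by rewrite filter_uniq // permutations_uniq.
- exact: enum_uniq.
- by move=> s; rewrite mem_filter mem_permutations => /andP[].
- by move=> s; rewrite /c /ncpoly_coef big_seq_cond;
    apply: subringP_sum => // t /andP[/pE].
- by move=> s; rewrite mem_filter => /andP[].
move=> a Ra; rewrite big_filter -[RHS](multilinearization Rring p0 wmax Ra).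
rewrite [LHS]big_mkcond; apply: eq_bigr => s _.
by case: eqVneq => // cs0; rewrite -/(c s) cs0 mul0r.
Qed.

End Kaplansky.

(** * Locally PI division rings *)

Section LocallyPI.
Variable D : unitRingType.
Hypothesis hD : is_division_ring D.
Implicit Types (S : seq D) (R : D -> Prop).

Lemma std_poly_over_center n : ncpoly_over_center (std_poly D n).
Proof.
by move=> t /std_poly_sign[] -> y; rewrite ?mul1r ?mulr1 ?mulN1r ?mulrN1.
Qed.

(** Generation by an arbitrary set, as needed for [gen_subalg S]; for membership in a finite list it
    unfolds to [gen_divring]. *)
Definition divring_closure R (x : D) : Prop :=
  forall P : D -> Prop, divring_closedP P -> (forall y, R y -> P y) -> P x.

Lemma divring_closureP R : divring_closedP (divring_closure R).
Proof.
split=> [P|x y Rx Ry P Pdiv PR|x y Rx Ry P Pdiv PR|x Rx P Pdiv PR];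
  first by case.
- by case: (Pdiv) => _ + _ _; apply; [apply: Rx|apply: Ry].
- by case: (Pdiv) => _ _ + _; apply; [apply: Rx|apply: Ry].
- by case: (Pdiv) => _ _ _; apply; apply: Rx.
Qed.

Lemma gen_divring_closed S : divring_closedP (gen_divring S).
Proof. exact: divring_closureP. Qed.

Lemma gen_subalg_central S z : central z -> gen_subalg S z.
Proof. by move=> zC P [+ _ _] _; apply. Qed.

Lemma gen_subalg_subring S : subringP (gen_subalg S).
Proof.
split=> [|x y Sx Sy P Palg PS|x y Sx Sy P Palg PS].
- by apply: gen_subalg_central => y; rewrite mul1r mulr1.
- by case: (Palg) => _ + _; apply; [apply: Sx|apply: Sy].
- by case: (Palg) => _ _; apply; [apply: Sx|apply: Sy].
Qed.

Lemma weakly_locally_finite_PI : weakly_locally_finite D -> locally_PI D.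
Proof.
move=> wlf S; have [b [bE [Eb _]]] := wlf S.
have Ediv := gen_divring_closed S; have Ering := divring_subringP Ediv.
set E := gen_divring S in bE Eb Ediv Ering.
(* The center of the centralizer of E: a commutative ring that contains both
   Z(E) and the center of D. *)
pose C x := (forall y, E y -> x * y = y * x) /\
  (forall y, (forall e, E e -> y * e = e * y) -> x * y = y * x).
have Cring : subringP C.
  split=> [|x y [xE xC] [yE yC]|x y [xE xC] [yE yC]].
  - by split=> y _; rewrite mul1r mulr1.
  - by split=> u uP; rewrite mulrBl mulrBr; [rewrite xE ?yE|rewrite xC ?yC].
  - split=> u uP; first by rewrite -mulrA yE // mulrA xE // mulrA.
    by rewrite -mulrA yC // mulrA xC // mulrA.
have centralC z : central z -> C z by move=> zC; split=> y _; apply: zC.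
have EC x : E x -> cspan C b x.
  move=> /Eb[c [szc [Zc ->]]].
  apply: (@cspan_sub_coef _ (center_of E)).
    (* An element of the center of [E] lies in [E], so it commutes with everything that centralizes
       [E]. *)
    by move=> z [Ez zE]; split=> // y yE; rewrite yE.
  have Zring := divring_subringP (center_divring Ediv).
  elim/big_rec: _ => [|i y _ Vy]; first exact: cspan0.
  apply: cspanD => //; apply: cspanZ => //; first exact: Zc.
  by apply: cspan_mem => //; apply: mem_nth.
have CS x : gen_subalg S x -> cspan C b x.
  apply; last by move=> s Ss; apply: EC => P _; apply.
  split=> [z zC|x' y|x' y Cx Cy].
  - rewrite -[z]mulr1; apply: cspanZ (centralC z zC) _ => //.
    by apply: EC; exact: subringP1.
  - exact: cspanB.
  elim/cspan_ind: x' / Cx => [|z v u Cz bv Cu]; first by rewrite mul0r;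
    exact: cspan0.
  rewrite mulrDl -mulrA; apply: cspanD => //; apply: cspanZ => //.
  (* Coefficients in [C] move past elements of [b], and a product of two elements of [b] is in [E],
     hence again in the span. *)
  elim/cspan_ind: y / Cy {Cu} => [|z' v' u' Cz' bv' Cu'].
    by rewrite mulr0; exact: cspan0.
  rewrite mulrDr mulrA -(proj1 Cz' v (bE v bv)) -mulrA.
  apply: cspanD => //; apply: cspanZ => //; apply: EC.
  exact: (subringPM Ering (bE v bv) (bE v' bv')).
exists (std_poly D (size b).+1); split.
- exact: std_poly_over_center.
- exact: std_poly_nonzero.
move=> a Sa; apply: (@std_poly_cspan _ C) =>
  // [x y [_ xC] [yE _]|x v [xE _] bv|i].
- exact: xC.
- by apply: xE; apply: bE.
- exact: CS.
Qed.

(* The division closure Q of F[S] is finite over its center, hence satisfies a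
   standard identity; its integer coefficients make it an identity of the
   division subring generated by S alone, whose center need not contain F. *)
Lemma locally_PI_weakly_finite : locally_PI D -> weakly_locally_finite D.
Proof.
move=> lPI S; have [p [pC p0 pS]] := lPI S.
have Qdiv := divring_closureP (gen_subalg S).
set Q := divring_closure (gen_subalg S) in Qdiv.
have SQ x : gen_subalg S x -> Q x by move=> Sx P _; apply.
have [V VQ QV] : finite_over_center Q.
  apply: (PI_finite_over_center hD Qdiv (gen_subalg_subring S) SQ _ _ p0 pS).
    by move=> P Pdiv PS x; apply.
  by move=> t /pC tC; apply: SQ; exact: gen_subalg_central.
have Ediv := gen_divring_closed S; have Ering := divring_subringP Ediv.
have EQ x : gen_divring S x -> Q x.
  by apply=> // s Ss; apply: SQ => P _; apply.
have [W WE EW] : finite_over_center (gen_divring S).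
  (* Here the division ring generated by [S] plays both roles, generating subring and division ring;
     the signs of the standard polynomial lie in it. *)
  apply: (@PI_finite_over_center D hD _ _ Ediv Ering _ _ (std_poly D (size
    V).+1)) => //.
  - move=> t /std_poly_sign[] ->; first exact: (subringP1 Ering).
    exact: (subringPN Ering (subringP1 Ering)).
  - exact: std_poly_nonzero.
  move=> a Ea; apply: (@std_poly_cspan _ (center_of Q)).
  - exact: divring_subringP (center_divring Qdiv).
  - by move=> x y [_ xQ] [Qy _]; apply: xQ.
  - by move=> x v [_ xQ] /VQ; apply: xQ.
  - by move=> i; apply: QV; exact: EQ.
exact: (centrally_finite_cspan hD Ediv WE EW).
Qed.

End LocallyPI.

Theorem theorem2p2 (D : unitRingType) (hD : is_division_ring D) :
  weakly_locally_finite D <-> locally_PI D.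
Proof.
split; first exact: weakly_locally_finite_PI.
exact: locally_PI_weakly_finite.
Qed.
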